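(* Let $l,a,b$ be positive integers and $p<q$ positive odd integers such that $q\ge 2l$, $a<b<2l-2$, $S^l_{a,b}(p)=S^l_{a,b}(q)$, and $U(a,b)\cap2\mathbb{Z}\cap[2l,3q-p]=\emptyset$. Then $U(a,b)\cap 2\mathbb{Z}\cap[2l,\infty)=\emptyset$.
   Context: For positive integers $a<b$, the Ulam sequence $U(a,b)$ is the increasing sequence whose first two terms are $a,b$ and in which each subsequent term is the smallest integer larger than the previous term that can be written as $u+v$ with $u<v$ earlier terms in exactly one way; we identify it with its set of terms, and $1_{U(a,b)}$ denotes its indicator function. For a positive integer $l$ and positive odd integer $k$, $S^l_{a,b}(k)$ is the finite sequence $\big(1_{U(a,b)}(k+2i)\big)_{i=0}^{l-2}$. *)

(* Defs.v *)
From mathcomp Require Import all_boot.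
From mathcomp Require Import boolp classical_sets.

Set Implicit Arguments.
Unset Strict Implicit.
Unset Printing Implicit Defensive.

Local Open Scope classical_set_scope.

Definition one_way (s : seq nat) (m : nat) : Prop :=
  exists! xy : nat * nat,
    [/\ xy.1 \in s, xy.2 \in s, xy.1 < xy.2 & xy.1 + xy.2 = m].

Definition is_ulam (a b : nat) (u : nat -> nat) : Prop :=
  [/\ u 0 = a, u 1 = b &
      forall n, let s := mkseq u n.+2 in
        [/\ u n.+1 < u n.+2, one_way s (u n.+2) &
            forall m, u n.+1 < m -> one_way s m -> u n.+2 <= m]].

(* The sequence specified by [is_ulam a b]; it exists and is unique when
   0 < a < b, see [ulamP] and [is_ulam_uniq] below, and is unspecified
   otherwise. *)
Definition ulam (a b : nat) : nat -> nat := get (is_ulam a b).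

Definition U (a b : nat) : set nat := range (ulam a b).

(* The l - 1 values of the indicator function of U(a,b) at k, k+2, ...,
   k + 2(l-2). *)
Definition Sseq (l a b k : nat) : seq nat :=
  [seq nat_of_bool (k + 2 * i \in U a b) | i <- iota 0 l.-1].

Lemma is_ulam_uniq a b u v : is_ulam a b u -> is_ulam a b v -> u = v.
Proof.
move=> [u0 u1 hu] [v0 v1 hv].
have E n : mkseq u n.+2 = mkseq v n.+2.
  elim: n => [|n IH]; first by rewrite /mkseq /= u0 u1 v0 v1.
  have e1 : u n.+1 = v n.+1.
    by rewrite -(nth_mkseq 0 u (ltnSn n.+1)) IH nth_mkseq.
  have [/= a1 a2 a3] := hu n; have [/= b1 b2 b3] := hv n.
  rewrite mkseqS IH [RHS]mkseqS; congr rcons.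
  apply/eqP; rewrite eqn_leq; apply/andP; split.
    by apply: a3; rewrite ?e1 // IH.
  by apply: b3; rewrite -?e1 // -IH.
apply/funext => n.
have lt_n : n < n.+2 by rewrite ltnS leqnSn.
by rewrite -(nth_mkseq 0 u lt_n) E nth_mkseq.
Qed.

Lemma one_way_last t x y : sorted ltn (rcons (rcons t x) y) ->
  one_way (rcons (rcons t x) y) (x + y).
Proof.
move=> so.
have sp : pairwise ltn (rcons (rcons t x) y) by rewrite -(sorted_pairwise ltn_trans).
move: sp; rewrite !pairwise_rcons => /andP[/allP hy /andP[/allP hx _]].
have xy : x < y by apply: hy; rewrite mem_rcons inE eqxx.
have ley z : z \in rcons (rcons t x) y -> z = y \/ z <= x.
  rewrite mem_rcons inE => /orP[/eqP|]; first by left.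
  rewrite mem_rcons inE => /orP[/eqP ->|/hx /ltnW]; by right.
exists (x, y); split => /=.
  by split => //; rewrite !(mem_rcons, inE) eqxx ?orbT.
move=> [x' y'] /= [_ /ley hy' xy' e].
case: hy' => [ey|hy'].
  by subst y'; move/eqP: e; rewrite eqn_add2r => /eqP ->.
have : x' + y' < x + y.
  by rewrite -addSn leq_add // ?(leq_trans xy') // (leq_trans hy') // ltnW.
by rewrite e ltnn.
Qed.

Definition next_spec (s : seq nat) (m : nat) : Prop :=
  [/\ last 0 s < m, one_way s m &
      forall k, last 0 s < k -> one_way s k -> m <= k].

Lemma next_specP t x y : 0 < x -> sorted ltn (rcons (rcons t x) y) ->
  exists m, next_spec (rcons (rcons t x) y) m.
Proof.
set s := rcons _ y => x0 so.
have ex : exists m, `[< last 0 s < m /\ one_way s m >].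
  exists (x + y); apply/asboolP; split; last exact: one_way_last.
  by rewrite last_rcons -[X in X < _]add0n ltn_add2r.
case: (ex_minnP ex) => m /asboolP[m1 m2] m3.
by exists m; split => // k k1 k2; apply: m3; apply/asboolP.
Qed.

Lemma is_ulam_ex a b : 0 < a -> a < b -> exists u, is_ulam a b u.
Proof.
move=> a0 ab.
pose nx s := get (next_spec s).
pose P n := iter n (fun s => rcons s (nx s)) [:: a; b].
have inv n : exists t x y,
    [/\ P n = rcons (rcons t x) y, 0 < x, sorted ltn (P n) & size (P n) = n.+2].
  elim: n => [|n [t [x [y [e x0 so sz]]]]].
    by exists [::], a, b; rewrite /P /= ab a0.
  have [m hm] : exists m, next_spec (P n) m by rewrite e; apply: next_specP; rewrite -?e.
  have [h1 _ _] : next_spec (P n) (nx (P n)) by apply: getI hm.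
  have sp : pairwise ltn (P n) by rewrite -(sorted_pairwise ltn_trans).
  exists (rcons t x), y, (nx (P n)); split.
  - by rewrite -e.
  - move: sp; rewrite e pairwise_rcons => /andP[/allP/(_ x) + _].
    by rewrite mem_rcons inE eqxx => /(_ isT); apply: leq_ltn_trans.
  - rewrite -[P n.+1]/(rcons (P n) (nx (P n))) (sorted_pairwise ltn_trans).
    rewrite pairwise_rcons sp andbT; apply/allP => z zP /=.
    apply: leq_ltn_trans h1; move: zP sp; rewrite e last_rcons mem_rcons inE => /orP[/eqP -> //|zP].
    by rewrite pairwise_rcons => /andP[/allP /(_ _ zP) /ltnW].
  - by rewrite /P /= size_rcons -/(P n) sz.
pose u n := nth 0 (P n) n.
have uP n : mkseq u n.+2 = P n.
  elim: n => [|n IH]; first by rewrite /mkseq /= /u /P.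
  rewrite mkseqS IH /u.
  have [_ [_ [_ [_ _ _ sz]]]] := inv n.
  congr rcons.
  rewrite -[P n.+2]/(rcons (rcons (P n) (nx (P n))) (nx (P n.+1))).
  by rewrite !nth_rcons size_rcons sz ltnSn ltnn eqxx.
have us n : u n.+2 = nx (P n).
  have := uP n.+1; rewrite mkseqS uP -[P n.+1]/(rcons (P n) (nx (P n))).
  by move/rcons_inj => [].
exists u; split => // n.
have [t [x [y [e x0 so sz]]]] := inv n.
have [m hm] : exists m, next_spec (P n) m by rewrite e; apply: next_specP; rewrite -?e.
have : next_spec (P n) (nx (P n)) by apply: getI hm.
rewrite /= uP us /next_spec.
suff -> : last 0 (P n) = u n.+1 by [].
by rewrite -uP mkseqS last_rcons.
Qed.

Lemma ulamP a b : 0 < a -> a < b -> is_ulam a b (ulam a b).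
Proof. by move=> a0 /(is_ulam_ex a0)[u]; apply: getI. Qed.

(* Main.v *)
Require Import Defs.
From mathcomp Require Import all_boot.
From mathcomp Require Import boolp classical_sets.
From mathcomp Require Import zify.

(** Let [d = q - p] and suppose that [N] is the least even term of [U(a,b)]
    with [N >= 2l].  Below [N] every odd term is the sum of an odd term and one
    of the even terms [< 2l], so the indicator of [U(a,b)] at an odd number
    depends only on the [l - 1] preceding odd numbers; hence [S(p) = S(q)]
    makes it [d]-periodic on odd numbers from [p] up to [N].

    Since [N > 3q - p], the representation [N = u + v], [u < v], has odd parts
    and [v > q], so [N - d = u + (v - d)].  If [u = v - d], then
    [(u - d) + (v + d)] is a second representation of [N].  Otherwise, as
    [N - d] is not a term, it has another representation [x + y], [x < y]; here
    [y > q], so [x + (y + d)] is a second representation of [N]. *)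

Local Open Scope classical_set_scope.

Definition distinct_sum (A : set nat) (m : nat) (xy : nat * nat) : Prop :=
  [/\ A xy.1, A xy.2, xy.1 < xy.2 & xy.1 + xy.2 = m].

Definition even_summand (A : set nat) (m e : nat) : Prop :=
  [/\ ~~ odd e, A e, e <= m & A (m - e)].

Lemma eq_exists_unique (T : Type) (P Q : T -> Prop) :
  (forall x, P x <-> Q x) -> (exists! x, P x) <-> (exists! x, Q x).
Proof.
move=> PQ; split=> -[x [/PQ Px ux]]; exists x; split=> // y /PQ; exact: ux.
Qed.

(** The summands of an odd number have opposite parities: they are distinct, and the even one
    determines the ordered pair. *)
Lemma odd_distinct_sum (A : set nat) m : odd m ->
  (exists! xy, distinct_sum A m xy) <-> (exists! e, even_summand A m e).
Proof.
move=> om; split.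
  move=> [[x y] [[/= Ax Ay xy xym] uxy]].
  exists (if odd x then y else x); split.
    case: ifP => ox; split=> //; try lia.
      by rewrite (_ : m - y = x) //; lia.
    by rewrite (_ : m - x = y) //; lia.
  move=> e [ev Ae em Am].
  have [lt_e|lt_e] : e < m - e \/ m - e < e by lia.
    have := uxy (e, m - e) (And4 Ae Am lt_e (subnKC em)).
    by case=> -> ->; rewrite (negbTE ev).
  have := uxy (m - e, e) (And4 Am Ae lt_e (subnK em)).
  by case=> -> ->; rewrite ifT //; lia.
move=> [e [[ev Ae em Am] ue]].
exists (if e < m - e then (e, m - e) else (m - e, e)); split.
  by case: ifP => lt_e; split=> //=; lia.
move=> [x y] [/= Ax Ay xy xym].
have [ox|ex] := boolP (odd x).
  have -> : e = y.
    apply: ue; split=> //; try lia.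
    by rewrite (_ : m - y = x) //; lia.
  by rewrite ifF; [congr pair|]; lia.
have -> : e = x.
  apply: ue; split=> //; try lia.
  by rewrite (_ : m - x = y) //; lia.
by rewrite ifT; [congr pair|]; lia.
Qed.

Section UlamSet.
Variables a b : nat.
Hypotheses (a_gt0 : 0 < a) (a_lt_b : a < b).

Let uP := ulamP a_gt0 a_lt_b.

Lemma ulam_lt : {mono ulam a b : m n / m < n}.
Proof.
apply: leqW_mono; apply: leq_mono; apply: homo_ltn; first exact: ltn_trans.
have [u0 u1 us] := uP => -[|n]; first by rewrite u0 u1.
by have [] := us n.
Qed.

Lemma mem_U_gt0 m : U a b m -> 0 < m.
Proof.
move=> [n _ <-]; case: n => [|n]; first by have [-> _ _] := uP.
by apply: leq_ltn_trans (leq0n (ulam a b 0)) _; rewrite ulam_lt.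
Qed.

Lemma mem_mkseq_ulam n x : x < ulam a b n ->
  (x \in mkseq (ulam a b) n) <-> U a b x.
Proof.
move=> xn; split.
  by move=> /mapP[i _ ->]; exists i.
move=> [i _ ix]; apply/mapP; exists i => //.
by rewrite mem_iota /= add0n -ulam_lt ix.
Qed.

(** All terms are positive, so both summands are below [m] and already occur in the prefix. *)
Lemma one_way_mkseq_ulam n m : m <= ulam a b n ->
  one_way (mkseq (ulam a b) n) m <-> exists! xy, distinct_sum (U a b) m xy.
Proof.
move=> mn; apply: eq_exists_unique => -[x y]; split=> -[/= sx sy xy xym].
  have Ux : U a b x by move: sx => /mapP[i _ ->]; exists i.
  have Uy : U a b y by move: sy => /mapP[i _ ->]; exists i.
  by split.
have x0 := mem_U_gt0 _ sx.
by split=> //=; apply/mem_mkseq_ulam => //; lia.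
Qed.

Lemma mem_U m : b < m ->
  U a b m <-> exists! xy, distinct_sum (U a b) m xy.
Proof.
have [u0 u1 us] := uP => bm; split.
  move=> [[|[|n]] _ um]; [lia|lia|].
  by apply/(one_way_mkseq_ulam n.+2); rewrite -um //; have [] := us n.
have ex : exists n, m <= ulam a b n.
  exists m; elim: (m) => // k IH.
  by apply: leq_ltn_trans IH _; rewrite ulam_lt.
(* At the least such index all earlier terms are below [m], so [m] competes for that place and
   cannot be smaller than the term there. *)
case: (ex_minnP ex) => -[|[|n]] mn min; [lia|lia|].
move=> /(one_way_mkseq_ulam _ _ mn) ow; exists n.+2 => //.
have [_ _ /(_ m)] := us n.
move=> /(_ _ ow) le_m; apply/eqP; rewrite eqn_leq mn andbT; apply: le_m.
by rewrite ltnNge; apply/negP => /min; rewrite ltnn.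
Qed.

Lemma mem_U_odd_periodic l p q N : odd p -> odd q -> p < q ->
  b < 2 * l - 2 -> Sseq l a b p = Sseq l a b q ->
  (forall e, U a b e -> ~~ odd e -> e < N -> e < 2 * l) ->
  forall n, odd n -> p <= n -> n + (q - p) < N ->
    U a b n <-> U a b (n + (q - p)).
Proof.
move=> op oq pq bl eqS small n.
elim/ltn_ind: n => n IH on pn nN.
(* [eqS] covers the first [l - 1] odd numbers from [p] on; past them, an even term [e <= 2l - 2]
   leaves [n - e >= p] for the induction. *)
have [n_lt|n_ge] := ltnP n (p + 2 * l.-1).
  have ni : p + 2 * ((n - p) %/ 2) = n by lia.
  have nj : q + 2 * ((n - p) %/ 2) = n + (q - p) by lia.
  have /eq_in_map/(_ ((n - p) %/ 2)) := eqS.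
  rewrite mem_iota ni nj => /(_ _) e.
  have {}e : (n \in U a b) = (n + (q - p) \in U a b).
    by have := e ltac:(lia); do 2 case: (_ \in _).
  by split=> /mem_set h; apply: set_mem; rewrite ?e // -e.
rewrite mem_U ?(mem_U (n + _)) ?odd_distinct_sum; try lia.
apply: eq_exists_unique => e; split=> -[ev Ue en Un]; split=> //; try lia.
- have := small e Ue ev ltac:(lia) => el.
  have e0 := mem_U_gt0 _ Ue.
  rewrite (_ : n + _ - e = n - e + (q - p)); last lia.
  by apply/(IH (n - e)) => //; lia.
- by have := small e Ue ev ltac:(have := mem_U_gt0 _ Un; lia); lia.
have := small e Ue ev ltac:(have := mem_U_gt0 _ Un; lia) => el.
have e0 := mem_U_gt0 _ Ue.
apply/IH; try lia.
by rewrite (_ : n - e + _ = n + (q - p) - e) //; lia.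
Qed.

End UlamSet.

Theorem theorem4p1 (l a b p q : nat)
  (l_gt0 : 0 < l) (a_gt0 : 0 < a) (b_gt0 : 0 < b)
  (p_gt0 : 0 < p) (q_gt0 : 0 < q) (p_odd : odd p) (q_odd : odd q)
  (p_lt_q : p < q) (q_ge : 2 * l <= q)
  (a_lt_b : a < b) (b_lt : b < 2 * l - 2)
  (eq_S : Sseq l a b p = Sseq l a b q)
  (no_even : U a b `&` [set n | 2 %| n] `&`
               [set n | 2 * l <= n <= 3 * q - p] = set0) :
  U a b `&` [set n | 2 %| n] `&` [set n | 2 * l <= n] = set0.
Proof.
apply/eqP/negPn/negP => /set0P ne.
have ex : exists n, `[< (U a b `&` [set n | 2 %| n] `&` [set n | 2 * l <= n]) n >].
  by have [n hn] := ne; exists n; apply/asboolP.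
case: (ex_minnP ex) => N /asboolP[[UN /= N2] Nl] minN.
have small e : U a b e -> ~~ odd e -> e < N -> e < 2 * l.
  move=> Ue ev eN; rewrite ltnNge; apply/negP => le.
  suff : N <= e by lia.
  by apply: minN; apply/asboolP; split=> //; split=> //=; lia.
have Nq : 3 * q - p < N.
  rewrite ltnNge; apply/negP => Nq.
  suff : (set0 : set nat) N by [].
  by rewrite -no_even; split=> //=; apply/andP.
have per := @mem_U_odd_periodic a b a_gt0 a_lt_b l p q N
  p_odd q_odd p_lt_q b_lt eq_S small.
have pos x := @mem_U_gt0 a b a_gt0 a_lt_b x.
set d := q - p in per.
have dE : p + d = q by rewrite /d; lia.
have bN : b < N by lia.
have /(mem_U _ _ a_gt0 a_lt_b _ bN)[[u v] [[/= Uu Uv uv uvN] uniqN]] := UN.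
have u0 := pos _ Uu.
(* Otherwise [u] and [v] are both even, hence below [2l], and [N < 4l <= 2q < 3q - p]. *)
have ov : odd v.
  apply/negPn/negP => ev.
  have := small v Uv ev ltac:(lia).
  by have := small u Uu ltac:(lia) ltac:(lia); lia.
have ou : odd u by lia.
(* Since [3q - p = 2q + d], [2v > N] gives [v > q], that is [v - d > p]. *)
have Uvd : U a b (v - d) by apply/per; rewrite ?subnK //; lia.
have [uvd|uvd] := eqVneq u (v - d).
  (* Here [N = 2u + d], so [u > q]; hence [u - d > p] and [v + d < N]. *)
  have Uud : U a b (u - d) by apply/per; rewrite ?subnK //; lia.
  have Uvd' : U a b (v + d) by apply/(per v) => //; lia.
  have : (u, v) = (u - d, v + d) by apply: uniqN; split=> //=; lia.
  by case; lia.
(* [N - d] is even, less than [N], and exceeds [2q >= 4l]. *)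
have UNd : ~ U a b (N - d).
  by move=> /small /(_ ltac:(lia) ltac:(lia)); lia.
apply: UNd; apply/mem_U => //; first lia.
(* Either of [u] and [v - d] may be the larger one. *)
exists (minn u (v - d), maxn u (v - d)); split.
  have [lt|lt] : u < v - d \/ v - d < u by lia.
    by rewrite (minn_idPl (ltnW lt)) (maxn_idPr (ltnW lt)); split=> //=; lia.
  by rewrite (minn_idPr (ltnW lt)) (maxn_idPl (ltnW lt)); split=> //=; lia.
move=> [x y] [/= Ux Uy xy xyN].
have x0 := pos _ Ux.
have oy : odd y.
  apply/negPn/negP => ey.
  have := small y Uy ey ltac:(lia).
  by have := small x Ux ltac:(lia) ltac:(lia); lia.
(* [y] exceeds half of [N - d > 2q], and [y + d = N - x < N]. *)
have Uyd : U a b (y + d) by apply/(per y) => //; lia.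
have : (u, v) = (x, y + d) by apply: uniqN; split=> //=; lia.
by case=> ux vy; congr pair; lia.
Qed.
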